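(* Let $N^H_1\le N^H_2\le\dots\le N^H_r$ and $N^K_1\le N^K_2\le\dots\le N^K_s$, $\sum_{j=1}^r N^H_j=\sum_{i=1}^s N^K_i=N$, be two different non-decreasing partitions of $N$ into positive integers. Let $a\ge 0$ be the largest index such that $N^H_j=N^K_j$ for all $1\le j\le a$, and put $N_a=\sum_{j=1}^a N^H_j=\sum_{i=1}^a N^K_i$ (with $N_a=0$ if $a=0$). Let $N_b$, $N_a<N_b\le N$, be the smallest number for which there exist $a<j_b\le r$ and $a<i_b\le s$ with $$N_a+\sum_{j=a+1}^{j_b}N^H_j=N_a+\sum_{i=a+1}^{i_b}N^K_i=N_b,$$ and put $N_{b-a}=N_b-N_a$. Let $H=O(N^H_1)\times\dots\times O(N^H_r)$ and $K=O(N^K_1)\times\dots\times O(N^K_s)$ be the maximal orthogonal Borel subgroups associated with these partitions. Then the subspace $V'=\{0\}\times\dots\times\{0\}\times\mathbb{R}^{N^H_{a+1}}\times\mathbb{R}^{N^H_{a+2}}\times\dots\times\mathbb{R}^{N^H_{j_b}}\times\{0\}\times\dots\times\{0\}$ of dimension $N_{b-a}$ is preserved by $H$ and $K$, and the group $\langle H,K\rangle$ acts transitively on the sphere $S(V')$.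
   Context: For a partition $(N_1,\dots,N_r)$ of $N$, the group $O(N_1)\times\dots\times O(N_r)\subset O(N)$ acts blockwise on $\mathbb{R}^N=\mathbb{R}^{N_1}\times\dots\times\mathbb{R}^{N_r}$ (consecutive blocks of coordinates with respect to a fixed orthonormal basis of $\mathbb{R}^N$, the same basis for $H$ and $K$). $\langle H,K\rangle$ is the closed subgroup of $O(N)$ topologically generated by $H$ and $K$; $S(V')$ is the unit sphere of $V'$. *)

(* Defs.v *)
From HB Require Import structures.
From mathcomp Require Import all_boot all_order all_algebra.
From mathcomp Require Import classical_sets reals topology normedtype.

Set Implicit Arguments.
Unset Strict Implicit.
Unset Printing Implicit Defensive.

Import Order.TTheory GRing.Theory Num.Theory.
Import numFieldNormedType.Exports.

Local Open Scope classical_set_scope.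
Local Open Scope ring_scope.

(* Sequences are indexed from 0: the j-th part (j >= 1) of a partition p is
   nth 0 p j.-1, and [psum p k] is the sum of its first k parts. *)
Definition nondecreasing_positive (p : seq nat) : Prop :=
  sorted leq p /\ forall n, n \in p -> (0 < n)%N.

Definition psum (p : seq nat) (k : nat) : nat :=
  (\sum_(0 <= j < k) nth 0 p j)%N.

Definition agree_upto (p q : seq nat) (a : nat) : Prop :=
  [/\ (a <= size p)%N, (a <= size q)%N
    & forall j, (j < a)%N -> nth 0%N p j = nth 0%N q j].

Definition largest_agreement (p q : seq nat) (a : nat) : Prop :=
  agree_upto p q a /\ forall a', agree_upto p q a' -> (a' <= a)%N.

Definition common_cut (N : nat) (p q : seq nat) (a jb ib n : nat) : Prop :=
  [/\ (psum p a < n <= N)%N,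
      (a < jb <= size p)%N, (a < ib <= size q)%N,
      (psum p a + \sum_(a <= j < jb) nth 0 p j)%N = n
    & (psum p a + \sum_(a <= i < ib) nth 0 q i)%N = n].

Definition smallest_common_cut (N : nat) (p q : seq nat) (a jb ib n : nat)
    : Prop :=
  common_cut N p q a jb ib n /\
  forall jb' ib' n', common_cut N p q a jb' ib' n' -> (n <= n')%N.

(* Elements of R^N are column vectors 'cV[R]_N, in the coordinates of the fixed
   orthonormal basis. *)
Section Orthogonal.
Context {R : realType}.

Definition orthogonal_group (N : nat) : set 'M[R]_N :=
  [set A | A *m A^T = 1%:M].

(* The topology on 'M[R]_N is the entrywise one; [orthogonal_group N] is closed
   in it, so being closed in 'M[R]_N and in O(N) agree for its subsets. *)
Definition closed_subgroup (N : nat) (G : set 'M[R]_N) : Prop :=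
  [/\ G `<=` @orthogonal_group N, G 1%:M,
      (forall A B, G A -> G B -> G (A *m B)),
      (forall A, G A -> G (invmx A))
    & closed G].

Definition topologically_generated (N : nat) (H K : set 'M[R]_N) :
    set 'M[R]_N :=
  smallest (@closed_subgroup N) (H `|` K).

Section Blocks.
Variables (N : nat) (p : seq nat).
Hypothesis pN : (\sum_(j < size p) nth 0%N p j = N)%N.

Definition block_diag (B : forall j : 'I_(size p), 'M[R]_(nth 0%N p j)) :
    'M[R]_N :=
  castmx (pN, pN) (\mxdiag_(j < size p) B j).

Definition block_orthogonal_group : set 'M[R]_N :=
  [set A | exists2 B : forall j : 'I_(size p), 'M[R]_(nth 0%N p j),
     (forall j, @orthogonal_group _ (B j)) & A = block_diag B].

(* The product of the factors R^{p_j}, a <= j < b (counted from 0), and of {0}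
   for the other j, obtained as the image of the projection of R^N onto these
   coordinate blocks. *)
Definition block_subspace (a b : nat) : {vspace 'cV[R]_N} :=
  limg (linfun (mulmx (block_diag (fun j => if (a <= j < b)%N then 1%:M else 0))
                : 'cV[R]_N -> 'cV[R]_N)).

End Blocks.

(* The library norm on matrices is the sup norm, hence this definition. *)
Definition euclidean_norm (N : nat) (x : 'cV[R]_N) : R :=
  Num.sqrt (\sum_(i < N) x i 0 ^+ 2).

Definition unit_sphere (N : nat) (V : {vspace 'cV[R]_N}) : set 'cV[R]_N :=
  [set x | x \in V /\ euclidean_norm x = 1].

Definition preserved_by (N : nat) (G : set 'M[R]_N) (V : {vspace 'cV[R]_N})
    : Prop :=
  forall A x, G A -> x \in V -> A *m x \in V.

Definition acts_transitively_on (N : nat) (G : set 'M[R]_N)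
    (S : set 'cV[R]_N) : Prop :=
  (forall A x, G A -> S x -> S (A *m x)) /\
  (forall x y, S x -> S y -> exists2 A, G A & A *m x = y).

End Orthogonal.

(* Main.v *)
(* Two coordinates of V' adjacent to each other lie in a common block of H or of
   K, since otherwise a cut common to both partitions would separate them, inside
   V'.  A reflection in a vector supported on one block belongs to H or to K; these
   act transitively on the circles in planes of two adjacent coordinates, hence
   carry every unit vector of V'
   to the first basis vector of V' by killing its coordinates one by one. *)

Require Import Defs.
From HB Require Import structures.
From mathcomp Require Import all_boot all_order all_algebra.
From mathcomp Require Import classical_sets reals topology normedtype.
From mathcomp Require Import zify ring.

Set Implicit Arguments.
Unset Strict Implicit.
Unset Printing Implicit Defensive.

Import Order.TTheory GRing.Theory Num.Theory.
Import numFieldNormedType.Exports.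

(** * Partial sums of a partition *)

Lemma psumS (p : seq nat) k : psum p k.+1 = (psum p k + nth 0 p k)%N.
Proof. by rewrite /psum big_nat_recr. Qed.

Lemma psum_cat (p : seq nat) j k :
  j <= k -> (psum p j + \sum_(j <= i < k) nth 0 p i)%N = psum p k.
Proof. by move=> jk; rewrite /psum -big_cat_nat. Qed.

Lemma leq_psum (p : seq nat) j k : j <= k -> psum p j <= psum p k.
Proof. by move=> /(psum_cat p) <-; exact: leq_addr. Qed.

Lemma psum_lt_inv (p : seq nat) j k : psum p j < psum p k -> j < k.
Proof. by case: (ltnP j k) => // /(leq_psum p); rewrite leqNgt => /negbTE->. Qed.

Lemma psum_size (p : seq nat) : psum p (size p) = \sum_(j < size p) nth 0 p j.
Proof. by rewrite /psum big_mkord. Qed.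

(** * Position of a coordinate among the blocks *)

Section BlockIndex.
Variables (N : nat) (p : seq nat).
Hypothesis pN : (\sum_(j < size p) nth 0%N p j = N)%N.

Definition block_index (k : 'I_N) : 'I_(size p) :=
  tagnat.sig1 (cast_ord (esym pN) k).

(** With blocks counted from 0, [k] is the sum of the parts before its block plus an offset smaller
    than its own part. This turns bounds on coordinates into comparisons of block indices. *)
Lemma psum_leq_block_index m (k : 'I_N) : (psum p m <= k) = (m <= block_index k).
Proof.
set s := cast_ord (esym pN) k; rewrite /block_index -/s.
have ks : k = psum p (tagnat.sig1 s) + tagnat.sig2 s :> nat.
  rewrite -[nat_of_ord k]/(nat_of_ord s) [LHS]tagnat.rect; congr (_ + _).
  rewrite /psum (big_nat_widen 0 _ (size p)) ?big_mkord //.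
  exact/ltnW/ltn_ord.
have s2 : tagnat.sig2 s < nth 0 p (tagnat.sig1 s) by exact: ltn_ord.
rewrite ks; case: (leqP m) => [/(leq_psum p)|/(leq_psum p)]; last first.
  by rewrite psumS => h; lia.
by move=> h; lia.
Qed.

End BlockIndex.

(** * Block-diagonal matrices and coordinate subspaces, entry by entry *)

Section BlockMatrices.
Local Open Scope ring_scope.
Context {R : realType}.
Variables (N : nat) (p : seq nat).
Hypothesis pN : (\sum_(j < size p) nth 0%N p j = N)%N.

Lemma mul_mxdiag_tr (B : forall j : 'I_(size p), 'M[R]_(nth 0%N p j)) :
  \mxdiag_j B j *m (\mxdiag_j B j)^T = \mxdiag_j (B j *m (B j)^T).
Proof.
rewrite tr_mxdiag [X in X *m _]/mxdiag mul_mxblock_mxdiag.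
apply: eq_mxblock => i j; case: eqVneq => [->|]; last by rewrite mul0mx.
by rewrite !conform_mx_id.
Qed.

(** A matrix vanishing between distinct blocks is the block-diagonal matrix of its diagonal
    submatrices, and its orthogonality splits into that of each block. *)
Lemma block_orthogonal_groupP (A : 'M[R]_N) :
  block_orthogonal_group pN A <->
  orthogonal_group A /\
  forall i j, block_index pN i != block_index pN j -> A i j = 0.
Proof.
rewrite /block_orthogonal_group /block_diag /block_index /orthogonal_group /=.
case: N / pN A => A; split=> [[B B1 ->]|[A1 A0]].
  rewrite castmx_id; split=> [|i j].
    by rewrite mul_mxdiag_tr -mxdiagZ; apply: eq_mxdiag.
  by rewrite !cast_ord_id mxE => /negbTE ->; rewrite mxE.
have Ad : A = \mxdiag_j (submxblock A j j).
  apply/matrixP => s t; rewrite [RHS]mxE.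
  case: eqVneq => [st|st]; last by rewrite mxE A0 ?cast_ord_id.
  rewrite -{1}(tagnat.sig2K s) -{1}(tagnat.sig2K t).
  move: (tagnat.sig2 s) (tagnat.sig2 t); rewrite -st => s2 t2.
  by rewrite conform_mx_id mxE.
exists (fun j => submxblock A j j); last by rewrite castmx_id.
by apply/eq_mxdiagP; rewrite -mul_mxdiag_tr -Ad mxdiagZ.
Qed.

(** The matrix [P] is the coordinate projection onto the interval, so its image consists of its
    fixed vectors. *)
Lemma mem_block_subspace a b (x : 'cV[R]_N) :
  reflect (forall i : 'I_N, ~~ (psum p a <= i < psum p b)%N -> x i 0 = 0)
          (x \in block_subspace pN a b).
Proof.
set P : 'M[R]_N := block_diag pN
  (fun j : 'I_(size p) => if (a <= j < b)%N then 1%:M else 0).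
have PE (y : 'cV[R]_N) (i : 'I_N) :
    (P *m y) i 0 = if (psum p a <= i < psum p b)%N then y i 0 else 0.
  have Pij j : P i j = ((psum p a <= i < psum p b)%N && (i == j))%:R.
    rewrite (ltnNge i) !(psum_leq_block_index pN) -ltnNge.
    rewrite /P /block_diag /block_index /= castmxE mxE.
    rewrite -(inj_eq (@cast_ord_inj _ _ (esym pN)) i j).
    move: (cast_ord _ i) (cast_ord _ j) => s t.
    rewrite -(can_eq tagnat.sigK) /tagnat.sig1 /tagnat.sig2.
    case: (tagnat.sig s) (tagnat.sig t) => [/= k l] [/= k' l'].
    case: eqP => [<-|nk] in l' *.
      rewrite conform_mx_id eq_Tagged /=.
      by case: ifP => _ /=; rewrite !mxE.
    by rewrite mxE; case: eqVneq => [[]//|_]; rewrite andbF.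
  rewrite mxE (bigD1 i) //= big1 => [|j ij]; last first.
    by rewrite Pij eq_sym (negbTE ij) andbF mul0r.
  by rewrite Pij eqxx andbT addr0; case: ifP; rewrite ?mul1r ?mul0r.
apply: (iffP memv_imgP) => [[y _ ->] i /negbTE ni|x0].
  by rewrite lfunE /= PE ni.
exists x; first exact: memvf.
apply/matrixP => i j; rewrite ord1 lfunE /= PE.
by case: ifPn => // /x0.
Qed.

(** The subspace is the image of [R^m] under the injective matrix [E] that shifts coordinates by
    [psum p a]. When [psum p b < psum p a] it is zero, in accordance with truncated subtraction. *)
Lemma dim_block_subspace a b :
  \dim (@block_subspace R _ _ pN a b) = (psum p b - psum p a)%N.
Proof.
have [ab|ba] := leqP (psum p a) (psum p b); last first.
  have -> : @block_subspace R _ _ pN a b = 0%VS.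
    apply/eqP; rewrite -subv0; apply/subvP => x /mem_block_subspace x0.
    rewrite memv0; apply/eqP/matrixP => i j; rewrite ord1 mxE; apply: x0.
    by lia.
  by rewrite dimv0; lia.
(* Past the end of [p] the default part is 0, so no partial sum exceeds [N]. *)
have bN : (psum p b <= N)%N.
  rewrite leqNgt; apply/negP => Nb.
  have := leq_psum p (leq_maxl b (size p)).
  have : psum p (maxn b (size p)) = N.
    rewrite -(psum_cat p (leq_maxr b (size p))) psum_size pN big_nat big1 ?addn0//.
    by move=> i /andP[si _]; rewrite nth_default.
  by lia.
set m := (psum p b - psum p a)%N.
pose E : 'M[R]_(N, m) := \matrix_(i, j) (i == psum p a + j :> nat)%:R.
have EE (y : 'cV[R]_m) (i : 'I_N) (j : 'I_m) :
    (i = psum p a + j :> nat)%N -> (E *m y) i 0 = y j 0.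
  move=> ij; rewrite mxE (bigD1 j) //= big1 => [|k kj]; last first.
    by rewrite mxE ij eqn_add2l eq_sym val_eqE (negbTE kj) mul0r.
  by rewrite mxE ij eqxx mul1r addr0.
have lt_j (j : 'I_m) : (psum p a + j < N)%N by have := ltn_ord j; rewrite /m; lia.
pose f : 'Hom('cV[R]_m, 'cV[R]_N) := linfun (mulmx E).
have -> : block_subspace pN a b = limg f.
  apply/vspaceP => x; apply/mem_block_subspace/memv_imgP => [x0|[y _ ->] i ni].
    exists (\col_j x (Ordinal (lt_j j)) 0); first exact: memvf.
    apply/matrixP => i j; rewrite ord1 lfunE /=.
    have [/andP[ai ib]|ni] := boolP (psum p a <= i < psum p b)%N.
      have im : (i - psum p a < m)%N by rewrite /m; lia.
      rewrite (EE _ _ (Ordinal im)) /=; last by lia.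
      by rewrite mxE; congr (x _ _); apply: val_inj => /=; lia.
    rewrite x0 // mxE big1 // => k _; rewrite mxE.
    by case: eqP; rewrite ?mul0r //; have := ltn_ord k; rewrite /m; lia.
  rewrite lfunE /= mxE big1 // => k _; rewrite mxE.
  by case: eqP; rewrite ?mul0r //; have := ltn_ord k; rewrite /m; lia.
rewrite limg_dim_eq ?dimvf /dim /= ?muln1 //.
apply/eqP; rewrite capfv -subv0; apply/subvP => y; rewrite memv_ker memv0 lfunE /=.
move=> /eqP Ey; apply/eqP/matrixP => j k; rewrite ord1.
by rewrite -(EE y (Ordinal (lt_j j))) // Ey !mxE.
Qed.

End BlockMatrices.

(** * Orthogonal matrices, reflections and closed subgroups of [O(N)] *)

Section Orthogonal.
Local Open Scope classical_set_scope.
Local Open Scope ring_scope.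
Context {R : realType}.
Variable N : nat.
Implicit Types (A B : 'M[R]_N) (x y : 'cV[R]_N).

Lemma orthogonal_trmxM A : orthogonal_group A -> A^T *m A = 1%:M.
Proof. exact: mulmx1C. Qed.

Lemma orthogonal_invmx A : orthogonal_group A -> invmx A = A^T.
Proof.
move=> A1; have [uA _] := mulmx1_unit A1.
by rewrite -[RHS]mul1mx -(mulVmx uA) -mulmxA A1 mulmx1.
Qed.

Lemma trmx_mul_col x y : x^T *m y = (\sum_i x i 0 * y i 0)%:M.
Proof.
apply/matrixP => i j; rewrite !ord1 !mxE eqxx mulr1n.
by apply: eq_bigr => k _; rewrite mxE.
Qed.

Lemma sqr_euclidean_norm x : euclidean_norm x ^+ 2 = \sum_i x i 0 ^+ 2.
Proof. by rewrite sqr_sqrtr // sumr_ge0 // => i _; rewrite sqr_ge0. Qed.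

Lemma orthogonal_sum_sqr A x : orthogonal_group A ->
  \sum_i (A *m x) i 0 ^+ 2 = \sum_i x i 0 ^+ 2.
Proof.
move=> A1; suff : (A *m x)^T *m (A *m x) = x^T *m x.
  by rewrite !trmx_mul_col => /matrixP/(_ 0 0); rewrite !mxE eqxx !mulr1n.
by rewrite trmx_mul mulmxA -(mulmxA x^T) orthogonal_trmxM // mulmx1.
Qed.

(* The Householder reflection in the hyperplane orthogonal to [x - y]. *)
Lemma orthogonal_reflection x y :
  \sum_i x i 0 ^+ 2 = \sum_i y i 0 ^+ 2 ->
  exists A, [/\ orthogonal_group A, A *m x = y &
    forall i j, i != j -> (x i 0 == y i 0) || (x j 0 == y j 0) -> A i j = 0].
Proof.
move=> xy; have [->|neq] := eqVneq x y.
  exists 1%:M; split; [by rewrite /orthogonal_group /= trmx1 mulmx1 |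
    by rewrite mul1mx | by move=> i j /negbTE ij _; rewrite mxE ij].
pose v := x - y; pose q := \sum_i v i 0 * v i 0.
have vv : v^T *m v = q%:M by rewrite trmx_mul_col.
have q0 : q != 0.
  apply: contra neq => /eqP q0; rewrite -subr_eq0 -/v; apply/eqP/matrixP => i j.
  rewrite ord1 [RHS]mxE; apply/eqP; rewrite -sqrf_eq0 expr2; apply/eqP.
  have v_ge0 k : true -> 0 <= v k 0 * v k 0 by rewrite -expr2 sqr_ge0.
  exact: (psumr_eq0P (P := predT) v_ge0 q0).
(* Since [x] and [y] have equal norms, |x - y|^2 = 2 <x - y, x>; hence the reflection subtracts
   exactly [v] from [x]. *)
have vx : v^T *m x = (q / 2)%:M.
  rewrite trmx_mul_col; congr (_%:M).
  suff -> : q = 2 * \sum_i v i 0 * x i 0 by field.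
  rewrite -[RHS]subr0 -[X in _ - X](subrr (\sum_i x i 0 ^+ 2)) [X in _ - (_ - X)]xy.
  rewrite mulr_sumr -!sumrB; apply: eq_bigr => i _.
  by rewrite !mxE; ring.
pose W := v *m v^T.
have WT : W^T = W by rewrite /W trmx_mul trmxK.
have WW : W *m W = q *: W.
  by rewrite /W mulmxA -(mulmxA v) vv mul_mx_scalar -scalemxAl.
exists (1%:M - (2 / q) *: W); split.
- rewrite /orthogonal_group /= [(_ - _)^T]linearB /= [(_ *: _)^T]linearZ /= trmx1 WT.
  rewrite mulmxBr mulmx1 mulmxBl mul1mx -scalemxAr -scalemxAl WW !scalerA.
  rewrite -scalerBl -addrA -opprD -scalerDl.
  by rewrite (_ : _ + _ = 0 :> R) ?scale0r ?subr0 //; field.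
- rewrite mulmxBl mul1mx -scalemxAl -mulmxA vx mul_mx_scalar scalerA.
  by rewrite (_ : 2 / q * (q / 2) = 1) ?scale1r ?subKr //; field.
(* Off the diagonal the entry is a multiple of [v i 0 * v j 0]. *)
- move=> i j /negbTE ij e; rewrite !mxE ij big_ord1 !mxE sub0r.
  by case/orP: e => /eqP ->; rewrite subrr ?mul0r ?mulr0 oppr0.
Qed.

Lemma closed_entry_eq (f : 'M[R]_N -> R) (c : R) :
  continuous f -> closed [set A | f A = c].
Proof.
by move=> cf; apply: (preimage_closed _ (@closed_eq R c)) => A _; exact: cf.
Qed.

(** The orthogonality relations between rows are polynomial equations in the entries, each cutting
    out a closed set. *)
Lemma closed_orthogonal_group : closed (@orthogonal_group R N).
Proof.
have -> : @orthogonal_group R N =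
  \bigcap_(ij in [set: 'I_N * 'I_N])
     [set A | \sum_k A ij.1 k * A ij.2 k = (ij.1 == ij.2)%:R].
  apply/seteqP; split=> A.
    move=> /matrixP A1 [i j] _ /=; move: (A1 i j); rewrite !mxE => <-.
    by apply: eq_bigr => k _; rewrite mxE.
  move=> A1; apply/matrixP => i j; have /= := A1 (i, j) I; rewrite !mxE => <-.
  by apply: eq_bigr => k _; rewrite mxE.
apply: closed_bigI => -[i j] _; apply: closed_entry_eq.
apply: continuous_big => [|k _ A]; first exact: add_continuous.
by apply: (@continuousM R _ (fun B : 'M[R]_N => B i k) (fun B => B j k));
  exact: (@coord_continuous R N N).
Qed.

(** The stabilizer in [O(N)] of the coordinate subspace given by [P]: an orthogonal matrix
    preserving it also preserves its orthogonal complement, so both mixed blocks vanish. Being a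
    closed subgroup, it serves to bound the topologically generated group from above. *)
Definition orthogonal_stabilizer (P : pred 'I_N) : set 'M[R]_N :=
  [set A | orthogonal_group A /\
           forall i j, P i != P j -> A i j = 0].

Lemma closed_subgroup_orthogonal_stabilizer (P : pred 'I_N) :
  closed_subgroup (orthogonal_stabilizer P).
Proof.
split=> [A []//| |A B [A1 A0] [B1 B0]|A [A1 A0]|].
- split=> [|i j ij]; first by rewrite /orthogonal_group /= trmx1 mulmx1.
  rewrite mxE (_ : (i == j) = false) //.
  by apply: contraNF ij => /eqP ->.
- split=> [|i j ij].
    by rewrite /orthogonal_group /= trmx_mul mulmxA -(mulmxA A) B1 mulmx1.
  rewrite mxE big1 // => k _.
  have [ik|ik] := eqVneq (P i) (P k); last by rewrite A0 ?mul0r.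
  by rewrite B0 ?mulr0 // -ik.
- rewrite orthogonal_invmx //; split=> [|i j ij].
    by rewrite /orthogonal_group /= trmxK; exact: orthogonal_trmxM.
  by rewrite mxE A0 // eq_sym.
- have -> : orthogonal_stabilizer P = @orthogonal_group R N `&`
    \bigcap_(ij in [set ij | P ij.1 != P ij.2]) [set A | A ij.1 ij.2 = 0].
    apply/seteqP; split=> A [A1 A0]; split=> //.
      by move=> [i j] /A0.
    by move=> i j; exact: (A0 (i, j)).
  apply: closedI; first exact: closed_orthogonal_group.
  by apply: closed_bigI => ij _; apply: closed_entry_eq; exact: coord_continuous.
Qed.

(** Every clause passes to an intersection of closed subgroups; containment in [O(N)] holds because
    [O(N)] is itself among those intersected. *)
Lemma closed_subgroup_topologically_generated (H K : set 'M[R]_N) :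
  H `<=` @orthogonal_group R N -> K `<=` @orthogonal_group R N ->
  closed_subgroup (topologically_generated H K).
Proof.
move=> HO KO; split.
- move=> A; apply; split=> [|B [/HO|/KO]//].
  (* A constant predicate imposes no vanishing, so its stabilizer is all of [O(N)]. *)
  have [O1 O2 O3 O4 O5] := closed_subgroup_orthogonal_stabilizer pred0.
  have -> : @orthogonal_group R N = orthogonal_stabilizer pred0.
    by apply/seteqP; split=> B; [split|case].
  by split.
- by move=> C [[]].
- by move=> A B GA GB C CHK; have [[_ _ CM _ _] _] := CHK; apply: CM;
    [exact: GA|exact: GB].
- by move=> A GA C CHK; have [[_ _ _ CV _] _] := CHK; apply: CV; exact: GA.
- by apply: closed_bigI => C [[]].
Qed.

(* Killing the coordinates one at a time from the last to the first carries [x]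
   to a multiple of the first basis vector of the interval. *)
Lemma adjacent_moves_transitive (G : set 'M[R]_N) (l h : nat) (i0 : 'I_N) :
  (i0 = l :> nat)%N -> (l < h)%N ->
  (forall A B, G A -> G B -> G (A *m B)) ->
  (forall (i j : 'I_N) x y, (l <= i <= j)%N -> (j <= i.+1)%N -> (j < h)%N ->
     (forall k, k != i -> k != j -> x k 0 = y k 0) ->
     \sum_k x k 0 ^+ 2 = \sum_k y k 0 ^+ 2 -> exists2 A, G A & A *m x = y) ->
  forall x, (forall i : 'I_N, ~~ (l <= i < h)%N -> x i 0 = 0) ->
    \sum_k x k 0 ^+ 2 = 1 -> exists2 A, G A & A *m x = delta_mx i0 0.
Proof.
move=> i0l lh GM Gmove.
(* Induction on the last coordinate [l + n] at which [x] may be nonzero. *)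
suff red (n : nat) x : (l + n < h)%N ->
    (forall i : 'I_N, ~~ (l <= i <= l + n)%N -> x i 0 = 0) ->
    \sum_k x k 0 ^+ 2 = 1 -> exists2 A, G A & A *m x = delta_mx i0 0.
  move=> x x0; apply: (red (h - l).-1); first by lia.
  by move=> i ni; apply: x0; lia.
elim: n x => [|n IHn] x lnh x0 x1.
  (* Only the coordinate [i0] is left, with value 1 or -1; the degenerate move with both indices
     equal to [i0] corrects the sign. *)
  apply: (Gmove i0 i0) => [|//||k ki0 _|]; try by lia.
    by rewrite mxE (negbTE ki0) /=; apply: x0; move: ki0; rewrite -val_eqE /=; lia.
  rewrite x1 (bigD1 i0) //= big1 => [|k /negbTE ki0]; last first.
    by rewrite mxE ki0 /= expr0n.
  by rewrite mxE !eqxx expr1n addr0.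
have [jN|Nj] := ltnP (l + n.+1) N; last first.
  apply: (IHn x) => // [|i ni]; first by lia.
  by apply: x0; have := ltn_ord i; lia.
have iN : (l + n < N)%N by lia.
pose i := Ordinal iN; pose j := Ordinal jN.
have ij : i != j by rewrite -val_eqE /=; lia.
(* The pair [(x i 0, x j 0)] is replaced by [(r, 0)] of the same length, which kills the last
   coordinate. *)
pose r := Num.sqrt (x i 0 ^+ 2 + x j 0 ^+ 2).
pose y : 'cV[R]_N := \col_k (if k == i then r else if k == j then 0 else x k 0).
have xy : \sum_k x k 0 ^+ 2 = \sum_k y k 0 ^+ 2.
  rewrite (bigD1 i) // (bigD1 j) 1?eq_sym //= [RHS](bigD1 i) // (bigD1 j) 1?eq_sym //=.
  rewrite !mxE eqxx eq_sym (negbTE ij) eqxx sqr_sqrtr ?addr_ge0 ?sqr_ge0 //.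
  rewrite expr0n add0r -addrA; congr (_ + (_ + _)).
  by apply: eq_bigr => k /andP[/negbTE ki /negbTE kj]; rewrite mxE ki kj.
have [A GA Axy] : exists2 A, G A & A *m x = y.
  apply: (Gmove i j) => //=; try by lia.
  by move=> k /negbTE ki /negbTE kj; rewrite mxE ki kj.
have [|k nk||B GB By] := IHn y; first by lia.
- rewrite mxE; case: eqP => [ki|_]; first by move: nk; rewrite ki /=; lia.
  by case: eqP => // /eqP; rewrite -val_eqE /= => kj; apply: x0; lia.
- by rewrite -xy.
by exists (B *m A); [exact: GM | rewrite -mulmxA Axy].
Qed.

End Orthogonal.

(** * Invariance under the block groups, and reflections in them *)

Section BlockGroups.
Local Open Scope classical_set_scope.
Local Open Scope ring_scope.
Context {R : realType}.
Variables (N : nat) (p : seq nat).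
Hypothesis pN : (\sum_(j < size p) nth 0%N p j = N)%N.

(** Membership in an interval between two cuts depends only on the block, so an entry joining inside
    to outside joins distinct blocks. *)
Lemma block_orthogonal_group_sub_stabilizer a b :
  @block_orthogonal_group R N p pN `<=`
  @orthogonal_stabilizer R N (fun i => psum p a <= i < psum p b)%N.
Proof.
move=> A /block_orthogonal_groupP [A1 A0]; split=> // i j ij; apply: A0.
apply: contra ij => /eqP ij.
by rewrite !(ltnNge _ (psum p b)) !(psum_leq_block_index pN) ij.
Qed.

Lemma orthogonal_stabilizer_preserves a b (A : 'M[R]_N) x :
  orthogonal_stabilizer (fun i : 'I_N => psum p a <= i < psum p b)%N A ->
  x \in block_subspace pN a b -> A *m x \in block_subspace pN a b.
Proof.
move=> [_ A0] /mem_block_subspace x0; apply/mem_block_subspace => i ni.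
rewrite mxE big1 // => j _.
have [jP|nj] := boolP (psum p a <= j < psum p b)%N; last by rewrite x0 ?mulr0.
by rewrite A0 ?mul0r // (negbTE ni) jP.
Qed.

(** Since [x - y] is supported on [i] and [j], the reflection carrying [x] to [y] has nonzero
    off-diagonal entries at most between [i] and [j], which share a block. *)
Lemma block_reflection (i j : 'I_N) (x y : 'cV[R]_N) :
  block_index pN i = block_index pN j ->
  (forall k, k != i -> k != j -> x k 0 = y k 0) ->
  \sum_k x k 0 ^+ 2 = \sum_k y k 0 ^+ 2 ->
  exists2 A, block_orthogonal_group pN A & A *m x = y.
Proof.
move=> ij xy /orthogonal_reflection [A [A1 Ax A0]]; exists A => //.
apply/block_orthogonal_groupP; split=> // k l kl.
have eq_xy m : (m != i) && (m != j) -> x m 0 == y m 0.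
  by case/andP=> mi mj; rewrite xy.
apply: A0; first by apply: contra kl => /eqP ->.
apply/orP; case: (boolP ((k != i) && (k != j))) => [/eq_xy|]; first by left.
(* Here [k] is [i] or [j], so [l], lying in another block, is neither. *)
rewrite negb_and !negbK => kij; right; apply: eq_xy; apply/andP.
have bk : block_index pN k = block_index pN i by case/orP: kij => /eqP ->.
by split; apply: contra kl => /eqP ->; rewrite bk // ij.
Qed.

End BlockGroups.

(* Adjacent coordinates separated in both partitions would be separated by a
   common cut. *)
Lemma adjacent_same_block (N : nat) (p q : seq nat) (a b c : nat)
    (pN : \sum_(j < size p) nth 0 p j = N) (qN : \sum_(j < size q) nth 0 q j = N)
    (i j : 'I_N) :
  psum p a = psum q a -> psum p b = psum q c ->
  (forall b' c', a < b' <= size p -> a < c' <= size q ->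
     psum p b' = psum q c' -> psum p b <= psum p b') ->
  psum p a <= i <= j -> j <= i.+1 -> j < psum p b ->
  block_index pN i = block_index pN j \/ block_index qN i = block_index qN j.
Proof.
move=> pqa pqb cut /andP[ai ij] ji jb.
have [|pij] := eqVneq (block_index pN i) (block_index pN j); first by left.
have [|qij] := eqVneq (block_index qN i) (block_index qN j); first by right.
(* A partition separating [i] from [j] has a cut exactly at [j]: the cut opening the block of [j] is
   above [i] and at most [j], while [j <= i.+1]. *)
suff sep (r : seq nat) (rN : \sum_(j < size r) nth 0 r j = N) :
    block_index rN i != block_index rN j -> psum r a <= i ->
    exists2 m, a < m <= size r & psum r m = j.
  have [b' b'P b'j] := sep _ _ pij ai.
  have [|c' c'P c'j] := sep _ _ qij; first by rewrite -pqa.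
  (* Both partitions cut at [j], so minimality gives [psum p b <= j], a contradiction. *)
  by have := cut _ _ b'P c'P; rewrite b'j c'j => /(_ erefl); lia.
move=> rij rai; pose m := nat_of_ord (block_index rN j).
have mj : psum r m <= j by rewrite (psum_leq_block_index rN).
have le_ij : block_index rN i <= m.
  rewrite -(psum_leq_block_index rN) (leq_trans _ ij) //.
  by rewrite (psum_leq_block_index rN).
have im : ~~ (psum r m <= i).
  rewrite (psum_leq_block_index rN) -ltnNge ltn_neqAle le_ij andbT.
  by apply: contra rij => /eqP/val_inj->.
exists m; last by lia.
rewrite (ltnW (ltn_ord _)) andbT; apply: (@psum_lt_inv r).
by lia.
Qed.

(** * Invariance of [V'] and transitivity on its sphere *)

Theorem proposition4p4 (R : realType) (N : nat) (NH NK : seq nat)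
    (NH_nondecreasing : nondecreasing_positive NH)
    (NK_nondecreasing : nondecreasing_positive NK)
    (NH_sum : \sum_(j < size NH) nth 0 NH j = N)
    (NK_sum : \sum_(i < size NK) nth 0 NK i = N)
    (NH_neq_NK : NH <> NK)
    (a : nat) (a_largest : largest_agreement NH NK a)
    (jb ib Nb : nat) (Nb_smallest : smallest_common_cut N NH NK a jb ib Nb) :
  let H := @block_orthogonal_group R N NH NH_sum in
  let K := @block_orthogonal_group R N NK NK_sum in
  let V' := @block_subspace R N NH NH_sum a jb in
  [/\ \dim V' = Nb - psum NH a,
      preserved_by H V',
      preserved_by K V'
    & acts_transitively_on (topologically_generated H K) (unit_sphere V')].
Proof.
move=> H K V'.
have psum_a : psum NH a = psum NK a.
  have [[_ _ agree] _] := a_largest.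
  by rewrite /psum big_nat [RHS]big_nat; apply: eq_bigr => j /agree.
have [[/andP[aNb NbN] /andP[ajb _] /andP[aib _] NHb NKb] minimal] := Nb_smallest.
have HNb : psum NH jb = Nb by rewrite -NHb psum_cat // ltnW.
have KNb : psum NK ib = Nb by rewrite -NKb psum_a psum_cat // ltnW.
(* Minimality of [Nb] in terms of partial sums; positivity of the parts puts [psum NH b'] strictly
   above [psum NH a], as a common cut requires. *)
have cut b' c' : a < b' <= size NH -> a < c' <= size NK ->
    psum NH b' = psum NK c' -> psum NH jb <= psum NH b'.
  move=> b'P c'P e; rewrite HNb; have [ab' _] := andP b'P; have [ac' _] := andP c'P.
  have NHa_lt : psum NH a < psum NH b'.
    rewrite -(psum_cat NH (ltnW ab')) -[X in X < _]addn0 ltn_add2l.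
    rewrite big_ltn //; apply: ltn_addr; case: NH_nondecreasing => _; apply.
    by apply: mem_nth; case/andP: b'P; exact: leq_trans.
  have b'N : psum NH b' <= N.
    by rewrite -NH_sum -psum_size; apply: leq_psum; case/andP: b'P.
  apply: (minimal b' c'); split=> //; first by rewrite NHa_lt.
    by rewrite psum_cat // ltnW.
  by rewrite psum_a psum_cat // ltnW.
(* The coordinates of [V']; both ends of this interval are cuts of both partitions, so [H] and [K]
   both stabilize it. *)
pose P (i : 'I_N) := psum NH a <= i < Nb.
have HP : (H `<=` orthogonal_stabilizer P)%classic.
  by rewrite /P -HNb; exact: block_orthogonal_group_sub_stabilizer.
have KP : (K `<=` orthogonal_stabilizer P)%classic.
  by rewrite /P psum_a -KNb; exact: block_orthogonal_group_sub_stabilizer.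
have PV A x : orthogonal_stabilizer P A -> x \in V' -> (A *m x)%R \in V'.
  by rewrite /P -HNb; exact: orthogonal_stabilizer_preserves.
have [GO G1 GM GV _] : closed_subgroup (topologically_generated H K).
  apply: closed_subgroup_topologically_generated => A; first by case/HP.
  by case/KP.
have HG : (H `<=` topologically_generated H K)%classic.
  by move=> A HA C [_]; apply; left.
have KG : (K `<=` topologically_generated H K)%classic.
  by move=> A KA C [_]; apply; right.
have norm1 (x : 'cV[R]_N) :
    euclidean_norm x = 1%R <-> (\sum_k x k ord0 ^+ 2 = 1)%R.
  rewrite -sqr_euclidean_norm; split=> [->|x1]; first by rewrite expr1n.
  by apply/eqP; rewrite -sqrp_eq1 ?x1 // sqrtr_ge0.
split.
- by rewrite dim_block_subspace HNb.
- by move=> A x /HP; exact: PV.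
- by move=> A x /KP; exact: PV.
split=> [A x GA [xV /norm1 x1]|].
  split; last by apply/norm1; rewrite orthogonal_sum_sqr //; exact: GO.
  (* The stabilizer is one of the closed subgroups containing [H] and [K], so it contains [A]. *)
  apply: PV xV; apply: GA; split; last by move=> B [/HP|/KP].
  exact: closed_subgroup_orthogonal_stabilizer.
have aN : psum NH a < N by exact: leq_trans aNb NbN.
(* Each move on adjacent coordinates is realised in [H] or in [K], whichever has both coordinates in
   one block. *)
have toe x : unit_sphere V' x ->
    exists2 A, topologically_generated H K A & (A *m x = delta_mx (Ordinal aN) 0)%R.
  move=> [/mem_block_subspace xV /norm1 x1].
  apply: (adjacent_moves_transitive (l := psum NH a) (h := Nb)) => //.
    move=> i j y z aij ji jNb yz yz2.
    have := adjacent_same_block (b := jb) (c := ib) NH_sum NK_sum psum_a _ cut aij ji.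
    rewrite HNb KNb => /(_ erefl jNb) [] ij.
      by have [A HA Ay] := block_reflection ij yz yz2; exists A => //; exact: HG.
    by have [A KA Ay] := block_reflection ij yz yz2; exists A => //; exact: KG.
  by move=> i; rewrite -HNb; exact: xV.
move=> x y /toe [A GA Ax] /toe [B GB By].
exists (invmx B *m A)%R; first by apply: GM; [exact: GV|].
rewrite -mulmxA Ax -By mulmxA mulVmx ?mul1mx //.
by have [] := mulmx1_unit (GO _ GB).
Qed.
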